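(* Let $\mathcal X$ be a finite multi-set of real symmetric $2\times2$ matrices satisfying the hypotheses of Lemma 7 (unique largest eigenvalue $\lambda_1$; unique second largest eigenvalue $\lambda_2$ whose eigenvector is not perpendicular to that of $\lambda_1$), and let $S=\mathrm{Sup}_{\mathrm{LE}}(\mathcal X)$. Define $\boldsymbol\varphi:\mathcal U(\mathcal X)\to\mathbb R^2$ by $\boldsymbol\varphi(Y)=(\lambda,\mu)$, where $\lambda\ge\mu$ are the eigenvalues of $Y$, and equip $\mathbb R^2$ with the lexicographic order $(a,b)\preccurlyeq(a',b')\iff a<a'\ \text{or}\ (a=a'\ \text{and}\ b\le b')$. Then: (i) $\boldsymbol\varphi$ is Loewner-monotone: $B\le_{\mathrm L}A$ implies $\boldsymbol\varphi(B)\preccurlyeq\boldsymbol\varphi(A)$ for $A,B\in\mathcal U(\mathcal X)$; (ii) $\boldsymbol\varphi$ is convex on $\mathcal U(\mathcal X)$ with respect to the order cone $K=\{x\in\mathbb R^2:x\succcurlyeq0\}$, i.e. $\alpha\boldsymbol\varphi(Y_1)+(1-\alpha)\boldsymbol\varphi(Y_2)-\boldsymbol\varphi(\alpha Y_1+(1-\alpha)Y_2)\in K$ for all $Y_1,Y_2\in\mathcal U(\mathcal X)$, $\alpha\in[0,1]$; (iii) $S$ is the unique minimiser of $\boldsymbol\varphi$ (with respect to $\preccurlyeq$) on the super-upper bound cone $\mathcal U_*(\mathcal X)$.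
   Context: $\mathrm{Sym}(2)$: real symmetric $2\times2$ matrices; $A\le_{\mathrm L}B$ means $B-A$ positive semidefinite; $\mathcal U(\mathcal X):=\{Y\in\mathrm{Sym}(2):X\le_{\mathrm L}Y\ \forall X\in\mathcal X\}$ (a convex set). $\mathrm{Sup}_{\mathrm{LE}}(\mathcal X):=\lim_{m\to\infty}\frac1m\log\sum_{X\in\mathcal X}\exp(mX)$. For positive semidefinite $Y=\lambda uu^{\mathsf T}+\mu vv^{\mathsf T}$, $Y^p:=\lambda^puu^{\mathsf T}+\mu^pvv^{\mathsf T}$. If all eigenvalues of matrices in $\mathcal X$ are nonnegative: $\mathcal X^p:=\{X^p:X\in\mathcal X\}$, $\mathcal U_p(\mathcal X):=\{Y\in\mathrm{Sym}(2)\text{ positive semidefinite}:Y^p\in\mathcal U(\mathcal X^p)\}$, and $\mathcal U_*(\mathcal X):=\bigcap_{p>0}\mathcal U_p(\mathcal X)$. If the smallest eigenvalue among the matrices of $\mathcal X$ is $-c<0$: $\mathcal U_*(\mathcal X):=\mathcal U_*(\mathcal X+c)-c$, where $\mathcal X+c:=\{X+cI:X\in\mathcal X\}$ and $\mathcal V-c:=\{Y-cI:Y\in\mathcal V\}$. Eigenvalue conventions: the eigenvalues of $\mathcal X$ form the multi-set of both eigenvalues of every matrix; unique means occurring exactly once. *)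

(* Defs.v *)
From HB Require Import structures.
From mathcomp Require Import all_boot all_order all_algebra.
From mathcomp Require Import all_classical all_reals all_analysis.
Set Implicit Arguments. Unset Strict Implicit. Unset Printing Implicit Defensive.
Import Order.TTheory GRing.Theory Num.Theory.
Import numFieldNormedType.Exports.
Local Open Scope classical_set_scope.
Local Open Scope ring_scope.

Section Defs.
Variable R : realType.
Notation M := 'M[R]_2.

Definition sym2 (A : M) : Prop := A^T = A.

Definition psd (A : M) : Prop :=
  sym2 A /\ forall v : 'cV[R]_2, 0 <= (v^T *m A *m v) ord0 ord0.

Definition loewner (A B : M) : Prop := psd (B - A).

(* The two eigenvalues (with multiplicity) of a symmetric 2x2 matrix:
   the roots of its characteristic polynomial x^2 - tr(A) x + det(A). *)
Definition eigmax (A : M) : R :=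
  (\tr A + Num.sqrt (\tr A ^+ 2 - 4 * \det A)) / 2.
Definition eigmin (A : M) : R :=
  (\tr A - Num.sqrt (\tr A ^+ 2 - 4 * \det A)) / 2.

(* Spectral functional calculus for a symmetric 2x2 matrix
   A = lam u u^T + mu v v^T  |->  f lam u u^T + f mu v v^T,
   written via the spectral projectors (A - mu I)/(lam - mu), (A - lam I)/(mu - lam). *)
Definition mxfun (f : R -> R) (A : M) : M :=
  let l := eigmax A in let m := eigmin A in
  if l == m then f l *: 1%:M
  else (l - m)^-1 *: (f l *: (A - m *: 1%:M) - f m *: (A - l *: 1%:M)).

Definition eigs (Xs : seq M) : seq R :=
  flatten [seq [:: eigmax X; eigmin X] | X <- Xs].

Definition lemma7_hyp (Xs : seq M) : Prop :=
  exists l1 l2 : R,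
    [/\ count (pred1 l1) (eigs Xs) = 1%N,
        (forall e, e \in eigs Xs -> e <= l1),
        count (pred1 l2) (eigs Xs) = 1%N,
        l2 < l1 &
        (forall e, e \in eigs Xs -> e != l1 -> e <= l2)] /\
        (forall X1 X2, X1 \in Xs -> X2 \in Xs ->
          forall u1 u2 : 'cV[R]_2, u1 != 0 -> u2 != 0 ->
          X1 *m u1 = l1 *: u1 -> X2 *m u2 = l2 *: u2 ->
          (u1^T *m u2) ord0 ord0 != 0).

Definition Ub (Xs : seq M) : set M :=
  [set Y | sym2 Y /\ forall X, X \in Xs -> loewner X Y].

Definition supLE_seq (Xs : seq M) (m : nat) : M :=
  (m%:R)^-1 *: mxfun (@ln R) (\sum_(X <- Xs) mxfun (@expR R) (m%:R *: X)).

(* Y^p for positive semidefinite Y *)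
Definition mxpow (p : R) (Y : M) : M := mxfun (fun x => x `^ p) Y.

(* U_p(X) and U_* for nonnegative spectrum *)
Definition Up (Xs : seq M) (p : R) : set M :=
  [set Y | psd Y /\ Ub (map (mxpow p) Xs) (mxpow p Y)].
Definition Ustar0 (Xs : seq M) : set M :=
  \bigcap_(p in [set p : R | 0 < p]) Up Xs p.

Definition eig_lowest (Xs : seq M) : R :=
  foldr Num.min (head 0 (eigs Xs)) (eigs Xs).

Definition Ustar (Xs : seq M) : set M :=
  let c := - eig_lowest Xs in
  if c <= 0 then Ustar0 Xs
  else [set Y - c *: 1%:M | Y in Ustar0 (map (fun X => X + c *: 1%:M) Xs)].

Definition phi (Y : M) : R * R := (eigmax Y, eigmin Y).

Definition lexle (x y : R * R) : Prop :=
  x.1 < y.1 \/ (x.1 = y.1 /\ x.2 <= y.2).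

End Defs.

(* Main.v *)
Require Import Defs.
From HB Require Import structures.
From mathcomp Require Import all_boot all_order all_algebra.
From mathcomp Require Import all_classical all_reals all_analysis.
From mathcomp Require Import ring lra zify.
Import Order.TTheory GRing.Theory Num.Theory.
Import numFieldNormedType.Exports.
Local Open Scope classical_set_scope.
Local Open Scope ring_scope.
Set Implicit Arguments.
Unset Strict Implicit.

(** The limit is [S = l1 u u^T + nu v v^T], where [u] is the unit eigenvector of
    the largest eigenvalue [l1], [v] is orthogonal to [u], and [nu] is the largest
    eigenvalue of the family whose eigenvector is not parallel to [u].  Rayleigh
    quotients show that the two eigenvalues of [sum_X exp (m X)] lie within
    constant factors of [exp (m l1)] and [exp (m nu)], and that its leading
    eigenvector tends to [u].

    Every [X^p] is below [S^p], so [S] lies in [U_*].  Conversely an upper bound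
    [Y] has largest eigenvalue at least [l1]; in case of equality [u] is an
    eigenvector of [Y], and if [mu] is the other eigenvalue, testing [X^p <= Y^p]
    on [v], for an [X] having [nu] as eigenvalue with eigenvector [w], gives
    [nu^p (w.v)^2 <= mu^p] for all [p], whence [nu <= mu].

    For monotonicity and convexity, the largest eigenvalue is the maximum of the
    Rayleigh quotient, and the second coordinate is the trace minus the first. *)

(** * Coordinates, quadratic forms and rotated diagonal forms *)

Lemma ord2_cases (k : 'I_2) : k = 0 \/ k = 1.
Proof. by case: k => [[|[|k]] hk] //; [left|right]; apply: val_inj. Qed.

Lemma matrix2P (R : realType) (A B : 'M[R]_2) :
  A 0 0 = B 0 0 -> A 0 1 = B 0 1 -> A 1 0 = B 1 0 -> A 1 1 = B 1 1 -> A = B.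
Proof.
move=> h00 h01 h10 h11; apply/matrixP => i j.
by case: (ord2_cases i) => ->; case: (ord2_cases j) => ->.
Qed.

Lemma sym2P (R : realType) (A : 'M[R]_2) : sym2 A <-> A 0 1 = A 1 0.
Proof.
split=> [h|h]; first by rewrite -{1}h mxE.
by apply: matrix2P; rewrite mxE.
Qed.

Lemma mxtrace2 (R : realType) (A : 'M[R]_2) : \tr A = A 0 0 + A 1 1.
Proof.
rewrite /mxtrace !big_ord_recl big_ord0 addr0; congr (_ + A _ _); exact: val_inj.
Qed.

Lemma det2 (R : realType) (A : 'M[R]_2) :
  \det A = A 0 0 * A 1 1 - A 0 1 * A 1 0.
Proof.
rewrite (expand_det_row A 0) !big_ord_recl big_ord0 addr0 /cofactor !det_mx11 !mxE.
have -> : lift (0 : 'I_2) (0 : 'I_1) = 1 by apply: val_inj.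
have -> : lift (1 : 'I_2) (0 : 'I_1) = 0 by apply: val_inj.
by rewrite /= expr0 expr1; ring.
Qed.

Definition qform (R : realType) (A : 'M[R]_2) (x y : R) : R :=
  A 0 0 * x ^+ 2 + (A 0 1 + A 1 0) * x * y + A 1 1 * y ^+ 2.

Lemma qformE (R : realType) (A : 'M[R]_2) (v : 'cV[R]_2) :
  (v^T *m A *m v) ord0 ord0 = qform A (v 0 0) (v 1 0).
Proof.
rewrite !mxE !big_ord_recl big_ord0 addr0 !mxE !big_ord_recl !big_ord0 !mxE.
have -> : lift ord0 (ord0 : 'I_1) = 1 :> 'I_2 by apply: val_inj.
have -> : ord0 = 0 :> 'I_2 by apply: val_inj.
have -> : ord0 = 0 :> 'I_1 by apply: val_inj.
by rewrite /qform; ring.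
Qed.

Lemma psdP (R : realType) (A : 'M[R]_2) :
  psd A <-> sym2 A /\ forall x y, 0 <= qform A x y.
Proof.
split=> -[sA pA]; split=> //.
  move=> x y; have := pA (\col_i (if i == 0 then x else y)).
  by rewrite qformE !mxE.
by move=> v; rewrite qformE.
Qed.

Lemma qformB (R : realType) (A B : 'M[R]_2) x y :
  qform (A - B) x y = qform A x y - qform B x y.
Proof. by rewrite /qform !mxE; ring. Qed.

Lemma qform_sum (R : realType) (I : Type) (r : seq I) (F : I -> 'M[R]_2) x y :
  qform (\sum_(i <- r) F i) x y = \sum_(i <- r) qform (F i) x y.
Proof.
elim: r => [|i r ih]; first by rewrite !big_nil /qform !mxE; ring.
by rewrite !big_cons -ih /qform !mxE; ring.
Qed.

Lemma sym2_sum (R : realType) (I : eqType) (r : seq I) (F : I -> 'M[R]_2) :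
  (forall i, i \in r -> sym2 (F i)) -> sym2 (\sum_(i <- r) F i).
Proof.
move=> h; apply/sym2P; rewrite !summxE; apply: eq_big_seq => i /h.
by move/sym2P.
Qed.

Lemma loewnerP (R : realType) (A B : 'M[R]_2) : sym2 A -> sym2 B ->
  loewner A B <-> forall x y, qform A x y <= qform B x y.
Proof.
move=> /sym2P sA /sym2P sB; split.
  by move=> /psdP[_ h] x y; have := h x y; rewrite qformB subr_ge0.
move=> h; apply/psdP; split; first by apply/sym2P; rewrite !mxE sA sB.
by move=> x y; rewrite qformB subr_ge0.
Qed.

(* [l w w^T + m w' w'^T] for the unit vector [w = (c, s)] and [w' = (- s, c)]. *)
Definition spec (R : realType) (l m c s : R) : 'M[R]_2 :=
  \matrix_(i, j)
    (if i == j then (if i == 0 then l * c ^+ 2 + m * s ^+ 2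
                     else l * s ^+ 2 + m * c ^+ 2)
     else (l - m) * c * s).

Lemma sym2_spec (R : realType) (l m c s : R) : sym2 (spec l m c s).
Proof. by apply/sym2P; rewrite !mxE. Qed.

Lemma qform_spec (R : realType) (l m c s x y : R) :
  qform (spec l m c s) x y =
  l * (c * x + s * y) ^+ 2 + m * (c * y - s * x) ^+ 2.
Proof. by rewrite /qform !mxE /=; ring. Qed.

(** A quarter turn of the frame exchanges the two eigenvalues, so later arguments may order them
    freely. *)
Lemma spec_swap (R : realType) (l m c s : R) : spec l m c s = spec m l (- s) c.
Proof. by apply: matrix2P; rewrite !mxE /=; ring. Qed.

Lemma scale_spec (R : realType) (k l m c s : R) :
  k *: spec l m c s = spec (k * l) (k * m) c s.
Proof. by apply: matrix2P; rewrite !mxE /=; ring. Qed.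

Lemma shift_spec (R : realType) (k l m c s : R) : c ^+ 2 + s ^+ 2 = 1 ->
  spec l m c s + k *: 1%:M = spec (l + k) (m + k) c s.
Proof.
move=> h; have {}h : s ^+ 2 = 1 - c ^+ 2 by rewrite -h; ring.
by apply: matrix2P; rewrite !mxE /=; ring: h.
Qed.

Lemma spec_scalar (R : realType) (l c s c' s' : R) :
  c ^+ 2 + s ^+ 2 = 1 -> c' ^+ 2 + s' ^+ 2 = 1 -> spec l l c s = spec l l c' s'.
Proof.
move=> h h'; have {}h : s ^+ 2 = 1 - c ^+ 2 by rewrite -h; ring.
have {}h' : s' ^+ 2 = 1 - c' ^+ 2 by rewrite -h'; ring.
by apply: matrix2P; rewrite !mxE /=; ring: h h'.
Qed.

(** Unit vectors with zero cross product agree up to sign, and [spec] is even in [(c, s)]. *)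
Lemma spec_parallel (R : realType) (l m c s c' s' : R) :
  c ^+ 2 + s ^+ 2 = 1 -> c' ^+ 2 + s' ^+ 2 = 1 -> c' * s - s' * c = 0 ->
  spec l m c s = spec l m c' s'.
Proof.
move=> h h' x0.
have hc : c = (c * c' + s * s') * c'.
  transitivity (c * (c' ^+ 2 + s' ^+ 2) + s' * (c' * s - s' * c)); last by ring.
  by rewrite h' x0; ring.
have hs : s = (c * c' + s * s') * s'.
  transitivity (s * (c' ^+ 2 + s' ^+ 2) - c' * (c' * s - s' * c)); last by ring.
  by rewrite h' x0; ring.
have y1 : (c * c' + s * s') ^+ 2 = 1.
  transitivity ((c ^+ 2 + s ^+ 2) * (c' ^+ 2 + s' ^+ 2) - (c' * s - s' * c) ^+ 2);
    first by ring.
  by rewrite h h' x0; ring.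
move: hc hs y1; move: (_ + _) => y hc hs y1.
by apply: matrix2P; rewrite !mxE /= hc hs; ring: y1.
Qed.

Lemma mxtrace_spec (R : realType) (l m c s : R) : c ^+ 2 + s ^+ 2 = 1 ->
  \tr (spec l m c s) = l + m.
Proof.
move=> h; have {}h : s ^+ 2 = 1 - c ^+ 2 by rewrite -h; ring.
by rewrite mxtrace2 !mxE /=; ring: h.
Qed.

(** Makes the square root in [eigmax] and [eigmin] the eigenvalue gap [|l - m|]. *)
Lemma disc_spec (R : realType) (l m c s : R) : c ^+ 2 + s ^+ 2 = 1 ->
  \tr (spec l m c s) ^+ 2 - 4 * \det (spec l m c s) = (l - m) ^+ 2.
Proof.
move=> h; rewrite mxtrace_spec // det2 !mxE /=.
have {}h : s ^+ 2 = 1 - c ^+ 2 by rewrite -h; ring.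
by ring: h.
Qed.

Lemma eigmax_spec (R : realType) (l m c s : R) : c ^+ 2 + s ^+ 2 = 1 ->
  m <= l -> eigmax (spec l m c s) = l.
Proof.
move=> h ml; rewrite /eigmax disc_spec // mxtrace_spec // sqrtr_sqr ger0_norm ?subr_ge0 //.
by field.
Qed.

Lemma eigmin_spec (R : realType) (l m c s : R) : c ^+ 2 + s ^+ 2 = 1 ->
  m <= l -> eigmin (spec l m c s) = m.
Proof.
move=> h ml; rewrite /eigmin disc_spec // mxtrace_spec // sqrtr_sqr ger0_norm ?subr_ge0 //.
by field.
Qed.

(** Links the projector formula of [mxfun] to eigenvalues given in any frame and order; the scalar
    case is separate because the formula divides by the gap. *)
Lemma mxfun_spec (R : realType) (f : R -> R) (l m c s : R) :
  c ^+ 2 + s ^+ 2 = 1 -> mxfun f (spec l m c s) = spec (f l) (f m) c s.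
Proof.
wlog ml : l m c s / m <= l.
  move=> H h; have [ml|lm] := leP m l; first exact: H.
  by rewrite spec_swap H ?ltW 1?sqrrN 1?addrC // [RHS]spec_swap.
move=> h; rewrite /mxfun eigmax_spec // eigmin_spec //.
case: eqVneq => [<-|lm].
  have {}h : s ^+ 2 = 1 - c ^+ 2 by rewrite -h; ring.
  by apply: matrix2P; rewrite !mxE /=; ring: h.
have lm0 : l - m != 0 by rewrite subr_eq0.
have e : spec (f l) (f m) c s = (l - m)^-1 *: ((l - m) *: spec (f l) (f m) c s).
  by rewrite scalerA mulVf // scale1r.
rewrite e; congr (_ *: _).
have {}h : s ^+ 2 = 1 - c ^+ 2 by rewrite -h; ring.
by apply: matrix2P; rewrite !mxE /=; ring: h.
Qed.

(** * Spectral decomposition and Rayleigh quotients *)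

Lemma eigmin_le_eigmax (R : realType) (A : 'M[R]_2) : eigmin A <= eigmax A.
Proof. by rewrite /eigmin /eigmax; have := sqrtr_ge0 (\tr A ^+ 2 - 4 * \det A); lra. Qed.

Lemma eigmaxDeigmin (R : realType) (A : 'M[R]_2) : eigmax A + eigmin A = \tr A.
Proof. by rewrite /eigmin /eigmax; field. Qed.

(** Unless [A] is diagonal, [(A 0 1, l - A 0 0)] is an eigenvector for [l] by the characteristic
    equation [hd]; dividing by its norm [n] gives the frame. *)
Lemma spectral2 (R : realType) (A : 'M[R]_2) : sym2 A ->
  exists c s, c ^+ 2 + s ^+ 2 = 1 /\ A = spec (eigmax A) (eigmin A) c s.
Proof.
move=> /sym2P sA; set l := eigmax A; set m := eigmin A.
have lm : m <= l := eigmin_le_eigmax A.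
have ht : m = A 0 0 + A 1 1 - l by rewrite -mxtrace2 -eigmaxDeigmin -/l -/m; ring.
have hd : (l - A 0 0) * (l - A 1 1) = A 0 1 ^+ 2.
  have D0 : 0 <= \tr A ^+ 2 - 4 * \det A.
    have -> : \tr A ^+ 2 - 4 * \det A = (A 0 0 - A 1 1) ^+ 2 + (2 * A 0 1) ^+ 2.
      by rewrite mxtrace2 det2 -sA; ring.
    by rewrite addr_ge0 ?sqr_ge0.
  have := sqr_sqrtr D0; rewrite /l /eigmax {2 3}mxtrace2 det2 -sA.
  move: (Num.sqrt _) => r hr; rewrite mxtrace2.
  have -> : A 0 1 ^+ 2 =
     (r ^+ 2 - (A 0 0 + A 1 1) ^+ 2 + 4 * (A 0 0 * A 1 1)) / 4 by rewrite hr; field.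
  by field.
have [b0|b0] := eqVneq (A 0 1) 0.
  move/eqP: hd; rewrite b0 expr0n /= mulf_eq0 !subr_eq0 => /orP[] /eqP la.
    exists 1, 0; split; first by ring.
    by apply: matrix2P; rewrite !mxE /= ?ht -?sA ?b0 ?la; ring.
  exists 0, 1; split; first by ring.
  by apply: matrix2P; rewrite !mxE /= ?ht -?sA ?b0 ?la; ring.
have la : l - A 0 0 != 0.
  by apply: contra b0 => /eqP e; rewrite -sqrf_eq0 -hd e mul0r.
pose n := Num.sqrt (A 0 1 ^+ 2 + (l - A 0 0) ^+ 2).
have n2 : n ^+ 2 = (l - A 0 0) * (l - m).
  rewrite /n sqr_sqrtr ?addr_ge0 ?sqr_ge0 //; rewrite -hd ht; ring.
have n0 : n != 0.
  rewrite gt_eqF // sqrtr_gt0 ltr_pwDl ?sqr_ge0 //.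
  by rewrite lt_neqAle sqr_ge0 eq_sym sqrf_eq0 b0.
have lm0 : l - m != 0.
  by apply: contra n0 => /eqP e; rewrite -sqrf_eq0 n2 e mulr0.
have c2 : (A 0 1 / n) ^+ 2 = (l - A 1 1) / (l - m).
  by rewrite expr_div_n n2 -hd; field; rewrite lm0 la.
have s2 : ((l - A 0 0) / n) ^+ 2 = (l - A 0 0) / (l - m).
  by rewrite expr_div_n n2; field; rewrite lm0 la.
have cs : (l - m) * (A 0 1 / n) * ((l - A 0 0) / n) = A 0 1.
  have -> : (l - m) * (A 0 1 / n) * ((l - A 0 0) / n) =
            (l - m) * (A 0 1 * (l - A 0 0)) / n ^+ 2 by field.
  by rewrite n2; field; rewrite lm0 la.
have lm' : l - (A 0 0 + A 1 1 - l) != 0 by rewrite -ht.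
exists (A 0 1 / n), ((l - A 0 0) / n); split.
  by rewrite c2 s2 ht; field.
by apply: matrix2P; rewrite !mxE /= ?c2 ?s2 ?cs -?sA // ht; field.
Qed.

Lemma qform_le_eigmax (R : realType) (A : 'M[R]_2) x y : sym2 A ->
  qform A x y <= eigmax A * (x ^+ 2 + y ^+ 2).
Proof.
move=> /spectral2[c [s [h e]]]; rewrite {1}e qform_spec.
have -> : x ^+ 2 + y ^+ 2 = (c * x + s * y) ^+ 2 + (c * y - s * x) ^+ 2.
  by rewrite -[LHS]mul1r -h; ring.
by rewrite mulrDr lerD2l ler_wpM2r ?sqr_ge0 // eigmin_le_eigmax.
Qed.

Lemma eigmax_attained (R : realType) (A : 'M[R]_2) : sym2 A ->
  exists c s, c ^+ 2 + s ^+ 2 = 1 /\ qform A c s = eigmax A.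
Proof.
move=> /spectral2[c [s [h e]]]; exists c, s; split=> //.
by rewrite {1}e qform_spec -!expr2 h; ring.
Qed.

(** * Monotonicity and convexity of the ordered eigenvalues *)

Lemma phi_monotone (R : realType) (A B : 'M[R]_2) :
  sym2 A -> sym2 B -> loewner B A -> lexle (phi B) (phi A).
Proof.
move=> sA sB /(loewnerP sB sA) h.
have [c [s [u e]]] := eigmax_attained sB.
have le1 : eigmax B <= eigmax A.
  by rewrite -e (le_trans (h c s)) // -[leRHS]mulr1 -u qform_le_eigmax.
rewrite /lexle /phi /=; move: le1; rewrite le_eqVlt => /orP[/eqP e1|]; last by left.
right; split=> //.
(* The trace is the sum of the form over the two coordinate axes. *)
have tBA : \tr B <= \tr A.
  have := lerD (h 1 0) (h 0 1); rewrite /qform !mxtrace2.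
  lra.
by have := eigmaxDeigmin A; have := eigmaxDeigmin B; lra.
Qed.

Lemma phi_convex (R : realType) (A B : 'M[R]_2) (a : R) :
  sym2 A -> sym2 B -> 0 <= a <= 1 ->
  lexle (0, 0)
    (a * (phi A).1 + (1 - a) * (phi B).1 - (phi (a *: A + (1 - a) *: B)).1,
     a * (phi A).2 + (1 - a) * (phi B).2 - (phi (a *: A + (1 - a) *: B)).2).
Proof.
move=> sA sB /andP[a0 a1]; set C := a *: A + _.
have sC : sym2 C.
  by move/sym2P: sA => sA; move/sym2P: sB => sB; apply/sym2P; rewrite !mxE sA sB.
have [c [s [u e]]] := eigmax_attained sC.
have le1 : eigmax C <= a * eigmax A + (1 - a) * eigmax B.
  have -> : eigmax C = a * qform A c s + (1 - a) * qform B c s.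
    by rewrite -e /qform /C !mxE; ring.
  rewrite lerD // ler_wpM2l ?subr_ge0 // -[leRHS]mulr1 -u; exact: qform_le_eigmax.
have tC : \tr C = a * \tr A + (1 - a) * \tr B.
  by rewrite !mxtrace2 /C !mxE; ring.
rewrite /lexle /=; move: le1; rewrite -subr_ge0 le_eqVlt => /orP[/eqP e1|]; last by left.
right; split=> //.
(* The trace is linear, so a tie in the first coordinate forces a tie in the second. *)
have -> : a * eigmin A + (1 - a) * eigmin B - eigmin C =
   a * (eigmax A + eigmin A) + (1 - a) * (eigmax B + eigmin B)
   - (eigmax C + eigmin C) - (a * eigmax A + (1 - a) * eigmax B - eigmax C) by ring.
by rewrite !eigmaxDeigmin tC -e1; lra.
Qed.

(** * The leading axis of a family and its second eigenvalue off that axis *)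

(** The order of [l] and [m] is left open. A matrix aligned with [(c1, s1)] may reach [l1] along
    that axis; any other has both eigenvalues at most [nu]. *)
Definition dominated (R : realType) (l1 nu c1 s1 : R) (X : 'M[R]_2) : Prop :=
  exists l m c s, [/\ c ^+ 2 + s ^+ 2 = 1, X = spec l m c s, l <= l1, m <= nu &
                     (c = c1 /\ s = s1) \/ l <= nu].

(** For unit vectors [c1 * s - s1 * c] is the sine of the angle between the axes. *)
Definition off_axis (R : realType) (nu c1 s1 : R) (X : 'M[R]_2) : Prop :=
  exists m c s, [/\ c ^+ 2 + s ^+ 2 = 1, X = spec nu m c s & c1 * s - s1 * c != 0].

(* [nu] is the largest eigenvalue of a matrix of [Xs] whose eigenvector is not
   parallel to the eigenvector [(c1, s1)] of the largest eigenvalue [l1]. *)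
Record sup_data (R : realType) (Xs : seq 'M[R]_2) (l1 nu c1 s1 : R) : Prop := SupData {
  sup_unit : c1 ^+ 2 + s1 ^+ 2 = 1;
  sup_lt : nu < l1;
  sup_top : exists2 X, X \in Xs & exists m, X = spec l1 m c1 s1;
  sup_dom : forall X, X \in Xs -> dominated l1 nu c1 s1 X;
  sup_off : exists2 X, X \in Xs & off_axis nu c1 s1 X }.

(** Take [nu] as the smaller eigenvalue if the larger one belongs to the axis [(c1, s1)], and as the
    larger one otherwise. *)
Lemma dominated_off_axis (R : realType) (l1 c1 s1 : R) (X : 'M[R]_2) :
  c1 ^+ 2 + s1 ^+ 2 = 1 -> sym2 X -> eigmax X <= l1 -> eigmin X < l1 ->
  eigmax X < l1 \/ X = spec (eigmax X) (eigmin X) c1 s1 ->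
  exists nu, [/\ nu < l1, dominated l1 nu c1 s1 X & off_axis nu c1 s1 X].
Proof.
move=> u sX lX mX H.
have par : X = spec (eigmax X) (eigmin X) c1 s1 ->
    exists nu, [/\ nu < l1, dominated l1 nu c1 s1 X & off_axis nu c1 s1 X].
  move=> e; exists (eigmin X); split=> //.
    by exists (eigmax X), (eigmin X), c1, s1; split=> //; left.
  exists (eigmax X), (- s1), c1; split; rewrite -?spec_swap //.
    by rewrite sqrrN addrC.
  have -> : c1 * c1 - s1 * - s1 = 1 by rewrite -u; ring.
  exact: oner_neq0.
case: H => [lX'|]; last exact: par.
have [c [s [h e]]] := spectral2 sX.
have [x0|x0] := eqVneq (c1 * s - s1 * c) 0.
  by apply: par; rewrite {1}e; apply: spec_parallel.
exists (eigmax X); split=> //.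
  by exists (eigmax X), (eigmin X), c, s; split=> //; [exact: eigmin_le_eigmax|right].
by exists (eigmin X), c, s.
Qed.

Lemma dominated_le (R : realType) (l1 nu nu' c1 s1 : R) (X : 'M[R]_2) :
  nu <= nu' -> dominated l1 nu c1 s1 X -> dominated l1 nu' c1 s1 X.
Proof.
move=> le [l [m [c [s [h e hl hm H]]]]]; exists l, m, c, s; split=> //.
  exact: le_trans le.
by case: H => [H|H]; [left|right; exact: le_trans le].
Qed.

(** Domination is monotone in [nu], so the maximum of the individual values serves the whole
    family. *)
Lemma max_off_axis (R : realType) (l1 c1 s1 : R) (Xs : seq 'M[R]_2) : Xs != [::] ->
  (forall X, X \in Xs ->
     exists nu, [/\ nu < l1, dominated l1 nu c1 s1 X & off_axis nu c1 s1 X]) ->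
  exists nu, [/\ nu < l1, forall X, X \in Xs -> dominated l1 nu c1 s1 X &
                 exists2 X, X \in Xs & off_axis nu c1 s1 X].
Proof.
elim: Xs => [//|X Xs ih] _ H.
have [nu [lt dom off]] := H X (mem_head _ _).
have [Xs0|Xs0] := eqVneq Xs [::].
  exists nu; rewrite Xs0; split=> //; last by exists X; rewrite ?mem_head.
  by move=> Z; rewrite inE => /eqP ->.
have [|nu' [lt' dom' [Z Zin off']]] := ih Xs0.
  by move=> Z Zin; apply: H; rewrite inE Zin orbT.
have [le|le] := leP nu nu'.
  exists nu'; split=> //; last by exists Z; rewrite // inE Zin orbT.
  by move=> W; rewrite inE => /orP[/eqP ->|/dom' //]; exact: dominated_le dom.
exists nu; split=> //; last by exists X; rewrite // mem_head.
by move=> W; rewrite inE => /orP[/eqP -> //|/dom']; exact: dominated_le (ltW le).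
Qed.

Lemma lemma7_sup_data (R : realType) (Xs : seq 'M[R]_2) :
  (forall X, X \in Xs -> sym2 X) -> lemma7_hyp Xs ->
  exists l1 nu c1 s1, sup_data Xs l1 nu c1 s1.
Proof.
move=> sXs [l1 [_ [[cnt top _ _ _] _]]].
have eX X : X \in Xs -> eigmax X \in eigs Xs /\ eigmin X \in eigs Xs.
  by move=> Xin; split; apply/flatten_mapP; exists X; rewrite // !inE eqxx ?orbT.
have : l1 \in eigs Xs by rewrite -has_pred1 has_count cnt.
case/flatten_mapP => X1 X1in; rewrite !inE => l1X1.
have [lX1 mX1] := eX X1 X1in.
have e1 : eigmax X1 = l1.
  apply/eqP; rewrite eq_le top //=; case/orP: l1X1 => /eqP -> //.
  exact: eigmin_le_eigmax.
(* As [l1] occurs once, splitting [Xs] at [X1] leaves no other eigenvalue equal to [l1], not even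
   [eigmin X1]. *)
have key X : X \in Xs -> eigmin X < l1 /\ (eigmax X < l1 \/ X = X1).
  move=> Xin; have [lX mX] := eX X Xin.
  move: X1in Xin cnt => /splitPr[t1 t2]; rewrite mem_cat inE.
  rewrite /eigs map_cat flatten_cat /= count_cat /= e1 eqxx => Xin cnt.
  have [n1 n2 m1] : [/\ count (pred1 l1) (eigs t1) = 0%N,
      count (pred1 l1) (eigs t2) = 0%N & eigmin X1 != l1].
    move: cnt; rewrite -/(eigs t1) -/(eigs t2).
    move: (count _ (eigs t1)) (count _ (eigs t2)) => a b.
    by case: (eigmin X1 == l1); split=> //; lia.
  have other t : X \in t -> count (pred1 l1) (eigs t) = 0%N -> eigmax X < l1.
    move=> Xt /eqP; rewrite -leqn0 leqNgt -has_count has_pred1 => nl.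
    rewrite lt_neqAle top // andbT; apply: contra nl => /eqP <-.
    by apply/flatten_mapP; exists X; rewrite // inE eqxx.
  have [->|XX1] := eqVneq X X1; first by rewrite lt_neqAle m1 top //; split=> //; right.
  have lt : eigmax X < l1.
    move: Xin; rewrite (negbTE XX1) /= => /orP[Xt|Xt]; exact: other Xt _.
  by split; [exact: le_lt_trans (eigmin_le_eigmax _) lt|left].
have [c1 [s1 [u eX1]]] := spectral2 (sXs _ X1in).
have [||nu [lt dom off]] := @max_off_axis R l1 c1 s1 Xs.
- by case: (Xs) X1in.
- move=> X Xin; have [lX mX] := eX X Xin; have [m1 l1'] := key X Xin.
  apply: dominated_off_axis => //; [exact: sXs|exact: top|].
  by case: l1' => [|->]; [left|right].
- exists l1, nu, c1, s1; split=> //.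
  by exists X1 => //; exists (eigmin X1); rewrite {1}eX1 e1.
Qed.

Lemma sup_data_shift (R : realType) (Xs : seq 'M[R]_2) (l1 nu c1 s1 k : R) :
  sup_data Xs l1 nu c1 s1 ->
  sup_data (map (fun X => X + k *: 1%:M) Xs) (l1 + k) (nu + k) c1 s1.
Proof.
case=> u lt [X Xin [m eX]] dom [Z Zin [m' [c [s [h eZ x0]]]]]; split=> //.
- by rewrite ltrD2r.
- exists (X + k *: 1%:M); first by apply/mapP; exists X.
  by exists (m + k); rewrite eX shift_spec.
- move=> _ /mapP[W Win ->]; have [l [m1 [c' [s' [h' -> hl hm H]]]]] := dom W Win.
  exists (l + k), (m1 + k), c', s'; split; rewrite ?shift_spec ?lerD2r //.
- exists (Z + k *: 1%:M); first by apply/mapP; exists Z.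
  by exists (m' + k), c, s; rewrite eZ shift_spec.
Qed.

(** * Upper bounds and the super-upper bound cone *)

(** Testing the matrix that attains [l1] against [Y] on [(c1, s1)] gives [l1 <= eigmax Y - (eigmax Y
    - eigmin Y) * x ^+ 2], where [x] is the sine of the angle between the leading axes. Equality
    forces [Y] scalar or [x = 0]. *)
Lemma Ub_eigmax (R : realType) (Xs : seq 'M[R]_2) (l1 nu c1 s1 : R) (Y : 'M[R]_2) :
  sup_data Xs l1 nu c1 s1 -> Ub Xs Y ->
  l1 <= eigmax Y /\ (eigmax Y = l1 -> Y = spec l1 (eigmin Y) c1 s1).
Proof.
case=> u _ [X Xin [m eX]] _ _ [sY /(_ X Xin)].
rewrite eX => /(loewnerP (sym2_spec _ _ _ _) sY) /(_ c1 s1).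
have [c [s [h eY]]] := spectral2 sY; have le := eigmin_le_eigmax Y.
rewrite qform_spec {1}eY qform_spec -!expr2 u.
have -> : m * (c1 * s1 - s1 * c1) ^+ 2 = 0 by ring.
rewrite expr1n mulr1 addr0.
have -> : (c * c1 + s * s1) ^+ 2 = 1 - (c * s1 - s * c1) ^+ 2.
  transitivity ((c ^+ 2 + s ^+ 2) * (c1 ^+ 2 + s1 ^+ 2) - (c * s1 - s * c1) ^+ 2);
    first by ring.
  by rewrite h u mulr1.
set x := c * s1 - s * c1 => H.
have x2 := sqr_ge0 x.
have p : 0 <= (eigmax Y - eigmin Y) * x ^+ 2 by rewrite mulr_ge0 ?subr_ge0.
split; first by lra.
move=> el; have /eqP : (eigmax Y - eigmin Y) * x ^+ 2 = 0.
  by apply/eqP; rewrite eq_le p andbT; lra.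
rewrite mulf_eq0 subr_eq0 sqrf_eq0 => /orP[/eqP lm|/eqP x0].
  by rewrite {1}eY -el -lm; apply: spec_scalar.
rewrite {1}eY -el; apply: spec_parallel => //.
by apply/eqP; rewrite -oppr_eq0; apply/eqP; rewrite -x0 /x; ring.
Qed.

Lemma spec_ge0 (R : realType) (l m c s : R) : c ^+ 2 + s ^+ 2 = 1 ->
  0 <= eigmin (spec l m c s) -> 0 <= l /\ 0 <= m.
Proof.
move=> h; have [le|/ltW le] := leP m l.
  by rewrite eigmin_spec // => m0; split=> //; exact: le_trans le.
rewrite spec_swap eigmin_spec //; last by rewrite sqrrN addrC.
by move=> l0; split=> //; exact: le_trans le.
Qed.

Lemma psd_eigmin_ge0 (R : realType) (A : 'M[R]_2) : psd A -> 0 <= eigmin A.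
Proof.
move=> /psdP[sA pA]; have [c [s [h e]]] := spectral2 sA.
have := pA (- s) c; rewrite {1}e qform_spec.
have -> : c * c - s * - s = 1 by rewrite -h; ring.
have -> : c * - s + s * c = 0 by ring.
by rewrite expr1n mulr1 expr0n mulr0 add0r.
Qed.

Lemma psd_spec (R : realType) (l m c s : R) : 0 <= l -> 0 <= m -> psd (spec l m c s).
Proof.
move=> l0 m0; apply/psdP; split; first exact: sym2_spec.
by move=> x y; rewrite qform_spec addr_ge0 // mulr_ge0 ?sqr_ge0.
Qed.

Lemma mxpow1 (R : realType) (A : 'M[R]_2) : sym2 A -> 0 <= eigmin A -> mxpow 1 A = A.
Proof.
move=> sA m0; have [c [s [h e]]] := spectral2 sA.
by rewrite {1}e /mxpow mxfun_spec // !powRr1 -?e // (le_trans m0) // eigmin_le_eigmax.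
Qed.


Lemma powR_dominated (R : realType) (p l1 nu c1 s1 : R) (X : 'M[R]_2) x y :
  0 <= p -> c1 ^+ 2 + s1 ^+ 2 = 1 -> nu <= l1 -> dominated l1 nu c1 s1 X ->
  0 <= eigmin X ->
  qform (mxpow p X) x y <= qform (spec (l1 `^ p) (nu `^ p) c1 s1) x y.
Proof.
move=> p0 u le [l [m [c [s [h -> hl hm H]]]]] /(spec_ge0 h)[l0 m0].
have mono a b : 0 <= a -> a <= b -> a `^ p <= b `^ p.
  by move=> a0 ab; apply: ge0_ler_powR; rewrite // nnegrE // (le_trans a0).
rewrite /mxpow mxfun_spec // !qform_spec.
case: H => [[-> ->]|lnu]; first by rewrite lerD // ler_wpM2r ?sqr_ge0 // mono.
have nu0 := le_trans l0 lnu.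
(* With both eigenvalues at most [nu], the comparison passes through the scalar matrix with entry
   [nu ^ p]. *)
apply: (@le_trans _ _ (nu `^ p * (x ^+ 2 + y ^+ 2))).
  have -> : x ^+ 2 + y ^+ 2 = (c * x + s * y) ^+ 2 + (c * y - s * x) ^+ 2.
    by rewrite -[LHS]mul1r -h; ring.
  by rewrite mulrDr lerD // ler_wpM2r ?sqr_ge0 // mono.
have -> : x ^+ 2 + y ^+ 2 = (c1 * x + s1 * y) ^+ 2 + (c1 * y - s1 * x) ^+ 2.
  by rewrite -[LHS]mul1r -u; ring.
by rewrite mulrDr lerD // ler_wpM2r ?sqr_ge0 // mono.
Qed.

Lemma sup_in_Ustar0 (R : realType) (Xs : seq 'M[R]_2) (l1 nu c1 s1 : R) :
  sup_data Xs l1 nu c1 s1 -> (forall X, X \in Xs -> 0 <= eigmin X) ->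
  Ustar0 Xs (spec l1 nu c1 s1).
Proof.
case=> u lt _ dom [Z Zin [mz [cz [sz [hz eZ _]]]]] pos p /= p0.
(* [nu] is nonnegative as an eigenvalue of the off-axis matrix [Z]. *)
have [nu0 _] : 0 <= nu /\ 0 <= mz by apply: (spec_ge0 hz); rewrite -eZ pos.
split; first by apply: psd_spec => //; rewrite (le_trans nu0) // ltW.
split; first by rewrite /mxpow mxfun_spec //; exact: sym2_spec.
move=> _ /mapP[X Xin ->].
rewrite {2}/mxpow mxfun_spec //; apply/loewnerP; [|exact: sym2_spec|].
  have [l [m [c [s [h -> _ _ _]]]]] := dom X Xin.
  by rewrite /mxpow mxfun_spec //; exact: sym2_spec.
by move=> x y; apply: powR_dominated => //; [exact: ltW|exact: ltW|exact: dom|exact: pos].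
Qed.

(** If [a < b], the powers of [a / b] tend to 0 and drop below [k]. *)
Lemma le_of_powers (R : realType) (a b k : R) : 0 <= a -> 0 <= b -> 0 < k ->
  (forall n, b ^+ n.+1 * k <= a ^+ n.+1) -> b <= a.
Proof.
move=> a0 b0 k0 H; rewrite leNgt; apply/negP => ab.
have b1 : 0 < b := le_lt_trans a0 ab.
have r1 : `|a / b| < 1 by rewrite ger0_norm ?divr_ge0 // ltr_pdivrMr // mul1r.
have /cvgr0Pnorm_lt /(_ k k0) [N _ /(_ N.+1)] := cvg_expr r1.
rewrite /= leqnSn => /(_ isT).
rewrite ger0_norm ?exprn_ge0 ?divr_ge0 // expr_div_n ltr_pdivrMr ?exprn_gt0 //.
by rewrite mulrC ltNge H.
Qed.

(* The second eigenvalue [mu] of [Y] satisfies [nu ^ p * x <= mu ^ p] for all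
   [p] and a fixed [x > 0]; letting [p] grow gives [nu <= mu]. *)
Lemma Ustar0_phi_ge (R : realType) (Xs : seq 'M[R]_2) (l1 nu c1 s1 : R) (Y : 'M[R]_2) :
  sup_data Xs l1 nu c1 s1 -> (forall X, X \in Xs -> sym2 X) ->
  (forall X, X \in Xs -> 0 <= eigmin X) -> Ustar0 Xs Y ->
  lexle (l1, nu) (phi Y) /\ (phi Y = (l1, nu) -> Y = spec l1 nu c1 s1).
Proof.
move=> sd sXs pos UY.
have [pY _] := UY 1 ltr01; have sY := pY.1; have mY := psd_eigmin_ge0 pY.
(* This is the condition at exponent 1. *)
have UbY : Ub Xs Y.
  have [_ []] := UY 1 ltr01; rewrite mxpow1 // => _ H; split=> // X Xin.
  rewrite -[X]mxpow1; [|exact: sXs|exact: pos].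
  by apply: H; apply/mapP; exists X.
have [le eq] := Ub_eigmax sd UbY.
split; last by rewrite /phi => -[e1 e2]; rewrite -e2; exact: eq.
rewrite /lexle /=; move: le; rewrite le_eqVlt => /orP[/eqP e1|]; last by left.
right; split=> //; have {}eq := eq (esym e1).
case: sd => u lt _ _ [X Xin [m [c [s [h eX x0]]]]].
have [nu0 m0] : 0 <= nu /\ 0 <= m by apply: (spec_ge0 h); rewrite -eX pos.
apply: (@le_of_powers _ _ _ ((c1 * s - s1 * c) ^+ 2)) => //.
  by rewrite lt_neqAle sqr_ge0 eq_sym sqrf_eq0 x0.
move=> n; have [_ [_ /(_ (mxpow n.+1%:R X))]] := UY n.+1%:R (ltr0Sn _ _).
rewrite map_f // => /(_ isT).
rewrite eX {1}eq /mxpow !mxfun_spec //.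
(* The normal [(- s1, c1)] to the leading axis removes the [l1] term of the power of [Y]. *)
move=> /(loewnerP (sym2_spec _ _ _ _) (sym2_spec _ _ _ _)) /(_ (- s1) c1).
rewrite !qform_spec !powR_mulrn // ?(le_trans mY (eigmin_le_eigmax _)) //; last first.
  by rewrite (le_trans nu0) // ltW.
have -> : c1 * - s1 + s1 * c1 = 0 by ring.
have -> : c1 * c1 - s1 * - s1 = 1 by rewrite -u; ring.
have -> : (c * - s1 + s * c1) ^+ 2 = (c1 * s - s1 * c) ^+ 2 by ring.
rewrite expr1n mulr1 expr0n mulr0 add0r; apply: le_trans.
by rewrite lerDl; apply: mulr_ge0; [exact: exprn_ge0|exact: sqr_ge0].
Qed.

Lemma phi_shift (R : realType) (A : 'M[R]_2) (k : R) : sym2 A ->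
  phi (A + k *: 1%:M) = (eigmax A + k, eigmin A + k).
Proof.
move=> sA; have [c [s [h e]]] := spectral2 sA; have le := eigmin_le_eigmax A.
by rewrite {1}e shift_spec // /phi eigmax_spec ?eigmin_spec // lerD2r.
Qed.

Lemma eig_lowest_le (R : realType) (Xs : seq 'M[R]_2) X : X \in Xs ->
  eig_lowest Xs <= eigmin X.
Proof.
move=> Xin; have : eigmin X \in eigs Xs.
  by apply/flatten_mapP; exists X; rewrite // !inE eqxx orbT.
(* The induction requires the starting value of the fold to be arbitrary. *)
rewrite /eig_lowest; move: (head _ _) => z; elim: (eigs Xs) => //= e es ih.
by rewrite inE ge_min => /orP[/eqP ->|/ih ->]; rewrite ?lexx ?orbT.
Qed.

Lemma Ustar_sup (R : realType) (Xs : seq 'M[R]_2) (l1 nu c1 s1 : R) :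
  sup_data Xs l1 nu c1 s1 -> (forall X, X \in Xs -> sym2 X) ->
  Ustar Xs (spec l1 nu c1 s1) /\
  forall Y, Ustar Xs Y ->
    lexle (l1, nu) (phi Y) /\ (phi Y = (l1, nu) -> Y = spec l1 nu c1 s1).
Proof.
move=> sd sXs; rewrite /Ustar; set k := - eig_lowest Xs.
have low X : X \in Xs -> 0 <= eigmin X + k.
  by move=> Xin; rewrite /k subr_ge0 eig_lowest_le.
case: ifP => k0.
  have pos X : X \in Xs -> 0 <= eigmin X by move=> /low; lra.
  by split; [exact: sup_in_Ustar0|move=> Y; exact: Ustar0_phi_ge].
(* For [k > 0] the family is moved to nonnegative spectrum; [phi] and the candidate move by the same
   [k], and the result is moved back. *)
have sd' := sup_data_shift k sd.
have sXs' X : X \in map (fun X => X + k *: 1%:M) Xs -> sym2 X.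
  by move=> /mapP[Z /sXs /sym2P sZ ->]; apply/sym2P; rewrite !mxE sZ.
have pos' X : X \in map (fun X => X + k *: 1%:M) Xs -> 0 <= eigmin X.
  by move=> /mapP[Z Zin ->]; have [_ ->] := phi_shift k (sXs _ Zin); exact: low.
have u := sup_unit sd.
split.
  exists (spec (l1 + k) (nu + k) c1 s1); first exact: sup_in_Ustar0.
  by rewrite -shift_spec // addrK.
move=> _ [Y UY <-].
have sY : sym2 Y by have [[]] := UY 1 ltr01.
have [lex eq] := Ustar0_phi_ge sd' sXs' pos' UY.
rewrite -scaleNr phi_shift //; split.
  by move: lex; rewrite /lexle /=; case=> [|[]]; [left; lra|right; lra].
move=> [e1 e2]; have -> : Y = spec (l1 + k) (nu + k) c1 s1.
  by apply: eq; rewrite /phi -e1 -e2 !subrK.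
by rewrite -shift_spec // scaleNr addrK.
Qed.

(** * Convergence of the log-exponential means *)

Lemma unit_norm_le1 (R : realType) (p q : R) : p ^+ 2 + q ^+ 2 = 1 ->
  `|p| <= 1 /\ `|q| <= 1.
Proof.
move=> h; have p2 := sqr_ge0 p; have q2 := sqr_ge0 q.
by split; rewrite -(@ler_pXn2r _ 2) ?nnegrE // real_normK ?num_real // expr1n; lra.
Qed.

(** Each entry of the difference combines [a - l], [b - m] and [l - m] times the sine of the angle
    between the frames. The coefficients are at most 1, the last being a sine or cosine of the sum
    of the frame angles. *)
Lemma spec_dist (R : realType) (a b c s l m c' s' : R) i j :
  c ^+ 2 + s ^+ 2 = 1 -> c' ^+ 2 + s' ^+ 2 = 1 ->
  `|spec l m c' s' i j - spec a b c s i j| <=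
  `|a - l| + `|b - m| + `|l - m| * `|c' * s - s' * c|.
Proof.
move=> h h'.
have [c1 s1] := unit_norm_le1 h.
have hs : s ^+ 2 = 1 - c ^+ 2 by rewrite -h; ring.
have hs' : s' ^+ 2 = 1 - c' ^+ 2 by rewrite -h'; ring.
have [z1 z2] : `|c * s' + c' * s| <= 1 /\ `|c * c' - s * s'| <= 1.
  apply: unit_norm_le1; transitivity ((c ^+ 2 + s ^+ 2) * (c' ^+ 2 + s' ^+ 2)).
    by ring.
  by rewrite h h' mulr1.
have bound p q z : `|p| <= 1 -> `|q| <= 1 -> `|z| <= 1 ->
    `|p * (a - l) + q * (b - m) + z * ((l - m) * (c' * s - s' * c))| <=
    `|a - l| + `|b - m| + `|l - m| * `|c' * s - s' * c|.
  move=> hp hq hz; rewrite -normrM.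
  apply: (le_trans (ler_normD _ _)); apply: lerD; last by rewrite [leLHS]normrM ler_piMl.
  by apply: (le_trans (ler_normD _ _)); apply: lerD; rewrite [leLHS]normrM ler_piMl.
have sq (p : R) : `|p| <= 1 -> `|p ^+ 2| <= 1.
  by move=> hp; rewrite normrX expr_le1.
have off : spec l m c' s' 0 1 - spec a b c s 0 1 =
    - (c * s * (a - l) + - (c * s) * (b - m) +
       (c * c' - s * s') * ((l - m) * (c' * s - s' * c))).
  by rewrite !mxE /=; ring: hs hs'.
have cs1 : `|c * s| <= 1 by rewrite normrM mulr_ile1.
case: (ord2_cases i) => ->; case: (ord2_cases j) => ->.
- have -> : spec l m c' s' 0 0 - spec a b c s 0 0 =
    - (c ^+ 2 * (a - l) + s ^+ 2 * (b - m) +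
       - (c * s' + c' * s) * ((l - m) * (c' * s - s' * c))).
    by rewrite !mxE /=; ring: hs hs'.
  by rewrite normrN; apply: bound; rewrite ?normrN ?sq.
- by rewrite off normrN; apply: bound; rewrite ?normrN.
- rewrite -(sym2P _).1 ?off; last exact: sym2_spec.
  rewrite -(sym2P _).1; last exact: sym2_spec.
  by rewrite off normrN; apply: bound; rewrite ?normrN.
- have -> : spec l m c' s' 1 1 - spec a b c s 1 1 =
    - (s ^+ 2 * (a - l) + c ^+ 2 * (b - m) +
       (c * s' + c' * s) * ((l - m) * (c' * s - s' * c))).
    by rewrite !mxE /=; ring: hs hs'.
  by rewrite normrN; apply: bound; rewrite ?normrN ?sq.
Qed.

Lemma sum_le_size (R : realType) (I : eqType) (r : seq I) (F : I -> R) (b : R) :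
  (forall i, i \in r -> F i <= b) -> \sum_(i <- r) F i <= (size r)%:R * b.
Proof.
elim: r => [|i r ih] H; first by rewrite big_nil mul0r.
rewrite big_cons /= -add1n natrD mulrDl mul1r lerD ?H ?mem_head // ih // => k kr.
by rewrite H // inE kr orbT.
Qed.

Lemma le_sum_mem (R : realType) (I : eqType) (r : seq I) (F : I -> R) i :
  i \in r -> (forall k, k \in r -> 0 <= F k) -> F i <= \sum_(k <- r) F k.
Proof.
move=> ir F0; rewrite (big_rem i) //= lerDl big_seq sumr_ge0 // => k kr.
exact/F0/(mem_rem kr).
Qed.

(* The Rayleigh quotients of the exponential sum along the eigenvector of [l1],
   its normal, and a direction off the axis pin down both eigenvalues up to
   constant factors, and bound the tilt of the leading eigenvector. *)
Lemma exp_sum_bounds (R : realType) (Xs : seq 'M[R]_2) (l1 nu c1 s1 : R) :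
  sup_data Xs l1 nu c1 s1 -> exists2 d : R, 0 < d & forall k : R, 0 <= k ->
  exists L M c s : R, [/\ c ^+ 2 + s ^+ 2 = 1,
    \sum_(X <- Xs) mxfun (@expR R) (k *: X) = spec L M c s,
    expR (k * l1) <= L <= (size Xs)%:R * expR (k * l1),
    d * expR (k * nu) <= M <= (size Xs)%:R * expR (k * nu) &
    (c1 * s - s1 * c) ^+ 2 * expR (k * l1) <= (size Xs)%:R * expR (k * nu)].
Proof.
case=> u lt [X1 X1in [m1 eX1]] dom [X2 X2in [m2 [c2 [s2 [h2 eX2 x0]]]]].
(* The squared sine is at most [2 * (p ^+ 2 + q ^+ 2)] by [key] below, and [expR (k * nu)] times
   either square is at most [M]. *)
exists ((c1 * s2 - s1 * c2) ^+ 2 / 4).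
  by rewrite divr_gt0 // lt_neqAle sqr_ge0 eq_sym sqrf_eq0 x0.
move=> k k0; set T := \sum_(X <- Xs) _; set n := (size Xs)%:R.
have E l m c s : c ^+ 2 + s ^+ 2 = 1 -> mxfun (@expR R) (k *: spec l m c s) =
    spec (expR (k * l)) (expR (k * m)) c s.
  by move=> h; rewrite scale_spec mxfun_spec.
have mono a b : a <= b -> expR (k * a) <= expR (k * b).
  by move=> ab; rewrite ler_expR ler_wpM2l.
have ge0 X x y : X \in Xs -> 0 <= qform (mxfun (@expR R) (k *: X)) x y.
  move=> /dom[l [m [c [s [h -> _ _ _]]]]]; rewrite E // qform_spec.
  by rewrite addr_ge0 // mulr_ge0 ?sqr_ge0 ?expR_ge0.
have rot c s x y : c ^+ 2 + s ^+ 2 = 1 ->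
    (c * x + s * y) ^+ 2 + (c * y - s * x) ^+ 2 = x ^+ 2 + y ^+ 2 :> R.
  by move=> h; rewrite -[RHS]mul1r -h; ring.
have top X x y : X \in Xs ->
    qform (mxfun (@expR R) (k *: X)) x y <= expR (k * l1) * (x ^+ 2 + y ^+ 2).
  move=> /dom[l [m [c [s [h -> hl hm _]]]]]; rewrite E // qform_spec.
  rewrite -(rot c s x y h) mulrDr lerD // ler_wpM2r ?sqr_ge0 // mono //.
  exact: le_trans (ltW lt).
(* On the normal to the leading axis an aligned matrix shows only its second eigenvalue; any other
   has both at most [nu]. *)
have nrm X : X \in Xs ->
    qform (mxfun (@expR R) (k *: X)) (- s1) c1 <= expR (k * nu).
  move=> /dom[l [m [c [s [h -> hl hm H]]]]]; rewrite E // qform_spec.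
  case: H => [[-> ->]|hl'].
    have -> : c1 * - s1 + s1 * c1 = 0 by ring.
    have -> : c1 * c1 - s1 * - s1 = 1 by rewrite -u; ring.
    by rewrite expr0n mulr0 add0r expr1n mulr1 mono.
  rewrite -[leRHS]mulr1 -u [c1 ^+ 2 + _]addrC -(sqrrN s1) -(rot c s (- s1) c1 h) mulrDr.
  by rewrite lerD // ler_wpM2r ?sqr_ge0 // mono.
have sT : sym2 T.
  apply: sym2_sum => X /dom[l [m [c [s [h -> _ _ _]]]]].
  by rewrite E //; exact: sym2_spec.
have qT X x y : X \in Xs -> qform (mxfun (@expR R) (k *: X)) x y <= qform T x y.
  move=> Xin; rewrite qform_sum.
  apply: (le_sum_mem (F := fun X => qform (mxfun (@expR R) (k *: X)) x y)) => //.
  by move=> Z Zin; exact: ge0.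
have [c [s [h eT]]] := spectral2 sT; have ML := eigmin_le_eigmax T.
move: (eigmax T) (eigmin T) ML eT => L M ML eT.
have qE x y : qform T x y = L * (c * x + s * y) ^+ 2 + M * (c * y - s * x) ^+ 2.
  by rewrite eT qform_spec.
have qL : qform T c s = L.
  rewrite qE -!expr2 h.
  have -> : c * s - s * c = 0 by ring.
  by rewrite expr1n expr0n mulr1 mulr0 addr0.
have qM : qform T (- s) c = M.
  rewrite qE; have -> : c * - s + s * c = 0 by ring.
  have -> : c * c - s * - s = 1 by rewrite -h; ring.
  by rewrite expr1n expr0n mulr1 mulr0 add0r.
have Lge : expR (k * l1) <= L.
  apply: (@le_trans _ _ (qform T c1 s1)).
    apply: le_trans (qT X1 c1 s1 X1in); rewrite eX1 E // qform_spec -!expr2 u.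
    by rewrite expr1n mulr1 lerDl mulr_ge0 ?sqr_ge0 ?expR_ge0.
  rewrite qE -[leRHS]mulr1 -u -(rot c s c1 s1 h) mulrDr.
  by rewrite lerD2l ler_wpM2r ?sqr_ge0.
have Lle : L <= n * expR (k * l1).
  rewrite -qL qform_sum; apply: sum_le_size => X Xin.
  by rewrite -[leRHS]mulr1 -h; exact: top.
(* The eigenvector [(- s, c)] for [M] cannot be nearly orthogonal to both [(c1, s1)] and [(c2, s2)];
   [p] and [q] are its inner products with them. *)
have Mge : (c1 * s2 - s1 * c2) ^+ 2 / 4 * expR (k * nu) <= M.
  have M1 : expR (k * nu) * (c1 * - s + s1 * c) ^+ 2 <= M.
    rewrite -qM; apply: le_trans (qT X1 (- s) c X1in); rewrite eX1 E // qform_spec.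
    apply: ler_wpDr; first by rewrite mulr_ge0 ?sqr_ge0 ?expR_ge0.
    by apply: ler_wpM2r; [exact: sqr_ge0|apply: mono; exact: ltW].
  have M2 : expR (k * nu) * (c2 * - s + s2 * c) ^+ 2 <= M.
    rewrite -qM; apply: le_trans (qT X2 (- s) c X2in); rewrite eX2 E // qform_spec.
    by rewrite lerDl mulr_ge0 ?sqr_ge0 ?expR_ge0.
  move: M1 M2; set p := c1 * - s + _; set q := c2 * - s + _ => M1 M2.
  have key : (c1 * s2 - s1 * c2) ^+ 2 <= 2 * (p ^+ 2 + q ^+ 2).
    have -> : (c1 * s2 - s1 * c2) ^+ 2 =
        2 * ((c2 ^+ 2 + s2 ^+ 2) * p ^+ 2 + (c1 ^+ 2 + s1 ^+ 2) * q ^+ 2)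
        - (s2 * p + s1 * q) ^+ 2 - (c1 * q + c2 * p) ^+ 2.
      transitivity ((c1 * s2 - s1 * c2) ^+ 2 * (c ^+ 2 + s ^+ 2)).
        by rewrite h mulr1.
      by rewrite /p /q; ring.
    rewrite h2 u !mul1r; have := sqr_ge0 (s2 * p + s1 * q).
    by have := sqr_ge0 (c1 * q + c2 * p); lra.
  have := ler_wpM2r (expR_ge0 (k * nu)) key.
  move: (expR _) M1 M2 => e M1 M2; lra.
have M0 : 0 <= M.
  by apply: le_trans Mge; rewrite mulr_ge0 ?expR_ge0 // divr_ge0 ?sqr_ge0.
(* This value bounds [M], the least Rayleigh quotient of [T], and also the tilt, whose square it
   contains with weight [L]. *)
have qn : qform T (- s1) c1 <= n * expR (k * nu).
  by rewrite qform_sum; apply: sum_le_size => X Xin; exact: nrm.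
have Mle : M <= n * expR (k * nu).
  apply: le_trans qn; rewrite qE -[leLHS]mulr1 -u [c1 ^+ 2 + _]addrC -(sqrrN s1).
  by rewrite -(rot c s (- s1) c1 h) mulrDr lerD2r ler_wpM2r ?sqr_ge0.
exists L, M, c, s; split=> //; rewrite ?Lge ?Mge //.
apply: le_trans qn; rewrite qE.
have -> : (c * - s1 + s * c1) ^+ 2 = (c1 * s - s1 * c) ^+ 2 by ring.
apply: ler_wpDr; first by rewrite mulr_ge0 ?sqr_ge0.
by rewrite mulrC; apply: ler_wpM2r => //; exact: sqr_ge0.
Qed.

(** Logarithms place [ln z - k * t] between [ln d] and [ln n]; dividing by [k] washes the constants
    out. *)
Lemma ln_dist_le (R : realType) (k t z d n : R) : 0 < k -> 0 < d -> 0 < n ->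
  d * expR (k * t) <= z <= n * expR (k * t) ->
  `|k^-1 * ln z - t| <= k^-1 * (`|ln d| + `|ln n|).
Proof.
move=> k0 d0 n0 /andP[dz zn].
have e0 := expR_gt0 (k * t).
have z0 : 0 < z by apply: lt_le_trans dz; exact: mulr_gt0.
have dz' : ln d + k * t <= ln z.
  by rewrite -{1}(expRK (k * t)) -lnM ?posrE // ler_ln ?posrE // mulr_gt0.
have zn' : ln z <= ln n + k * t.
  by rewrite -{1}(expRK (k * t)) -lnM ?posrE // ler_ln ?posrE // mulr_gt0.
have -> : k^-1 * ln z - t = k^-1 * (ln z - k * t) by field; rewrite gt_eqF.
rewrite normrM gtr0_norm ?invr_gt0 // ler_wpM2l ?invr_ge0 ?(ltW k0) //.
rewrite ler_norml; have := ler_norm (ln n); have := ler_norm (- ln d).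
by rewrite normrN; have := normr_ge0 (ln d); have := normr_ge0 (ln n); lra.
Qed.

(** Shifting past index 0, where the inverse of 0 is 0, leaves the harmonic sequence. *)
Lemma cvg_natinv (R : realType) : (fun m : nat => (m%:R : R)^-1) @ \oo --> (0 : R).
Proof. by rewrite -cvg_shiftS; exact: cvg_harmonic. Qed.

Lemma supLE_cvg (R : realType) (Xs : seq 'M[R]_2) (l1 nu c1 s1 : R) i j :
  sup_data Xs l1 nu c1 s1 ->
  (fun m : nat => supLE_seq Xs m i j) @ \oo --> spec l1 nu c1 s1 i j.
Proof.
move=> sd; have [d d0 H] := exp_sum_bounds sd.
have u := sup_unit sd; have lt := sup_lt sd.
set n : R := (size Xs)%:R in H.
have n1 : 1 <= n.
  rewrite /n ler1n lt0n; have [X Xin _] := sup_top sd.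
  by apply/eqP => /size0nil e; move: Xin; rewrite e.
have n0 : 0 < n := lt_le_trans ltr01 n1.
pose C := `|ln 1| + `|ln n| + (`|ln d| + `|ln n|).
(* The exponential bound on the squared tilt is weakened to a multiple of [1 / m], so that the error
   bound is continuous in [t = 1 / m] and vanishes at 0. *)
pose g (t : R) := C * t + (l1 - nu) * Num.sqrt (n / (l1 - nu) * t).
have g0 : (fun m : nat => g (m%:R)^-1) @ \oo --> (0 : R).
  have -> : 0 = C * 0 + (l1 - nu) * Num.sqrt (n / (l1 - nu) * 0) :> R.
    by rewrite mulr0 mulr0 sqrtr0; ring.
  apply: cvgD; first by apply: cvgM; [exact: cvg_cst|exact: cvg_natinv].
  apply: cvgM; first exact: cvg_cst.
  apply: (@continuous_cvg _ _ _ _ _ _ (@Num.sqrt R)); first exact: sqrt_continuous.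
  by apply: cvgM; [exact: cvg_cst|exact: cvg_natinv].
apply/cvgrPdist_le => e e0; near=> m.
have m0 : 0 < m%:R :> R by rewrite ltr0n; near: m; exists 1%N.
apply: (@le_trans _ _ (g (m%:R)^-1)); last first.
  apply: (le_trans (ler_norm _)); near: m.
  by move/cvgr0Pnorm_le: g0; exact.
have [L [M [c [s [h eT bL bM bx]]]]] := H _ (ltW m0).
rewrite /supLE_seq eT mxfun_spec // scale_spec.
apply: (le_trans (spec_dist _ _ _ _ _ _ h u)).
have dL := ln_dist_le m0 ltr01 n0 (k := m%:R) (t := l1) (z := L).
rewrite mul1r in dL; move/(_ bL): dL => dL.
have dM := ln_dist_le m0 d0 n0 bM.
rewrite /g; apply: lerD.
  by apply: (le_trans (lerD dL dM)); rewrite -mulrDr mulrC.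
rewrite gtr0_norm ?subr_gt0 // ler_wpM2l ?subr_ge0 ?(ltW lt) //.
rewrite -sqrtr_sqr ler_wsqrtr //.
move: bx; rewrite -ler_pdivlMr ?expR_gt0 // => /le_trans; apply.
rewrite -[leLHS]mulrA -expRN -expRD -[leRHS]mulrA ler_wpM2l ?(ltW n0) //.
have -> : m%:R * nu - m%:R * l1 = - (m%:R * (l1 - nu)) by ring.
rewrite expRN -invfM lef_pV2 ?posrE ?expR_gt0 ?mulr_gt0 ?subr_gt0 //.
(* Uses [expR x >= 1 + x >= x] at [x = m * (l1 - nu)]. *)
by rewrite mulrC; apply: le_trans (expR_ge1Dx _); lra.
Unshelve. all: by end_near. Qed.

(** * Antisymmetry of the lexicographic order and uniqueness of the minimiser *)

Lemma lexle_anti (R : realType) (x y : R * R) : lexle x y -> lexle y x -> x = y.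
Proof.
case: x y => a b [a' b']; rewrite /lexle /=.
case=> [h|[e h]] [h'|[e' h']]; try (exfalso; lra).
by congr (_, _); lra.
Qed.

Unset Implicit Arguments.

Theorem theorem4 (R : realType) (Xs : seq 'M[R]_2) :
  (forall X, X \in Xs -> sym2 X) ->
  lemma7_hyp Xs ->
  (* (i) Loewner monotonicity *)
  (forall A B, Ub Xs A -> Ub Xs B -> loewner B A -> lexle (phi B) (phi A)) /\
  (* (ii) K-convexity, K = {x | 0 <= x lexicographically} *)
  (forall Y1 Y2 (a : R), Ub Xs Y1 -> Ub Xs Y2 -> 0 <= a <= 1 ->
     lexle (0, 0)
       (a * (phi Y1).1 + (1 - a) * (phi Y2).1 - (phi (a *: Y1 + (1 - a) *: Y2)).1,
        a * (phi Y1).2 + (1 - a) * (phi Y2).2 - (phi (a *: Y1 + (1 - a) *: Y2)).2)) /\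
  (* (iii) S = Sup_LE(X) exists and is the unique minimiser of phi on U_*(X) *)
  (exists S : 'M[R]_2,
     (forall i j, (fun m : nat => supLE_seq Xs m i j) @ \oo --> S i j) /\
     Ustar Xs S /\
     (forall Y, Ustar Xs Y -> lexle (phi S) (phi Y)) /\
     (forall Y, Ustar Xs Y -> (forall Z, Ustar Xs Z -> lexle (phi Y) (phi Z)) -> Y = S)).
Proof.
move=> sXs hyp; split; first by move=> A B [sA _] [sB _]; exact: phi_monotone.
split; first by move=> A B a [sA _] [sB _]; exact: phi_convex.
have [l1 [nu [c1 [s1 sd]]]] := lemma7_sup_data sXs hyp.
have [US lower] := Ustar_sup sd sXs.
have phiS : phi (spec l1 nu c1 s1) = (l1, nu).
  by rewrite /phi eigmax_spec ?eigmin_spec ?(sup_unit sd) // ltW // (sup_lt sd).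
exists (spec l1 nu c1 s1); rewrite phiS; split; first by move=> i j; exact: supLE_cvg.
split=> //; split; first by move=> Y /lower[].
(* By antisymmetry a minimiser has image [(l1, nu)], and the equality case of [lower] identifies
   it. *)
move=> Y UY min; have [leY eqY] := lower Y UY; apply: eqY.
by apply: lexle_anti => //; rewrite -phiS; exact: min.
Qed.
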